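(* Let $(X,D,P)$ be a complete perturbed metric space with exact metric $d=D-P$, and let $M\ge 1$ be a constant such that $D(x,y)\le M\,d(x,y)$ for all $x,y\in X$. Let $T:X\to X$ and $h\ge 0$ satisfy $$D(Tx,Ty)\le h\,\bigl(D(x,Ty)+D(y,Tx)\bigr),\qquad x,y\in X,$$ and $2Mh<1$. Then $T$ has a unique fixed point, and for every $x_0\in X$ the Picard iteration $x_{n+1}=Tx_n$ converges to it in $(X,d)$.
   Context: A perturbed metric space $(X,D,P)$ consists of a nonempty set $X$ and two functions $D,P:X\times X\to[0,\infty)$ such that $d(x,y):=D(x,y)-P(x,y)$ is a metric on $X$, called the exact metric. Neither $D$ nor $P$ is assumed symmetric. $(X,D,P)$ is called complete if the metric space $(X,d)$ is complete. *)

(* Defs.v *)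
From HB Require Import structures.
From mathcomp Require Import all_boot all_order all_algebra.
From mathcomp Require Import all_classical all_reals all_analysis.

Set Implicit Arguments.
Unset Strict Implicit.
Unset Printing Implicit Defensive.

Import Order.TTheory GRing.Theory Num.Theory.

Local Open Scope classical_set_scope.
Local Open Scope ring_scope.

Definition is_metric (R : realType) (X : Type) (d : X -> X -> R) : Prop :=
  [/\ forall x y, 0 <= d x y,
      forall x y, d x y = 0 <-> x = y,
      forall x y, d x y = d y x
    & forall x y z, d x z <= d x y + d y z].

Record perturbedMetricSpace (R : realType) := PerturbedMetricSpace {
  pm_carrier :> Type;
  pm_nonempty : inhabited pm_carrier;
  pm_D : pm_carrier -> pm_carrier -> R;
  pm_P : pm_carrier -> pm_carrier -> R;
  pm_D_ge0 : forall x y, 0 <= pm_D x y;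
  pm_P_ge0 : forall x y, 0 <= pm_P x y;
  pm_metric : is_metric (fun x y => pm_D x y - pm_P x y) }.

Definition exact_metric (R : realType) (X : perturbedMetricSpace R) (x y : X)
  : R := pm_D x y - pm_P x y.

Section exact_metric_space.
Context (R : realType) (X : perturbedMetricSpace R).

Let exact_metricxx (x : X) : exact_metric x x = 0.
Proof. by have [_ d0 _ _] := pm_metric X; apply/d0. Qed.

Let exact_metric_positivity (x y : X) : exact_metric x y = 0 -> x = y.
Proof. by have [_ d0 _ _] := pm_metric X; move/d0. Qed.

Let exact_metric_sym (x y : X) : exact_metric x y = exact_metric y x.
Proof. by have [_ _ ds _] := pm_metric X; exact: ds. Qed.

Let exact_metric_triangle (y x z : X) :
  exact_metric x z <= exact_metric x y + exact_metric y z.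
Proof. by have [_ _ _ dt] := pm_metric X; exact: dt. Qed.

(* The topology and uniformity of a perturbed metric space are those of its
   exact metric, which becomes the distance [mdist] of the carrier. *)
HB.instance Definition _ := gen_eqMixin (pm_carrier X).
HB.instance Definition _ := gen_choiceMixin (pm_carrier X).
HB.instance Definition _ := @isMetric.Build R (pm_carrier X)
  (@exact_metric R X) exact_metricxx exact_metric_positivity
  exact_metric_sym exact_metric_triangle.

End exact_metric_space.

Lemma mdist_exactE (R : realType) (X : perturbedMetricSpace R) (x y : X) :
  mdist x y = exact_metric x y.
Proof. by []. Qed.

(* The library's [completeType] requires a distinguished point, so the
   convergence of Cauchy sequences is stated directly. *)
Definition pm_complete (R : realType) (X : perturbedMetricSpace R) : Prop :=
  forall u : nat -> X, cauchy (u @ \oo) -> exists l : X, u @ \oo --> l.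

(* Main.v *)
Require Import Defs.
From HB Require Import structures.
From mathcomp Require Import all_boot all_order all_algebra.
From mathcomp Require Import all_classical all_reals all_analysis.
From mathcomp Require Import lra.

Import Order.TTheory GRing.Theory Num.Theory.

Local Open Scope classical_set_scope.
Local Open Scope ring_scope.

(** Since d <= D <= M d, the hypothesis on D makes T a Chatterjea contraction
    of d with constant k = M h < 1/2.  For such a map the defects d(x, Tx)
    control distances: (1 - 2k) d(x, y) <= (1 + k) (d(x, Tx) + d(y, Ty)).  The
    defects decay geometrically along orbits, with ratio k / (1 - k) < 1, so
    orbits are Cauchy; the limit of one orbit is a fixed point, and the same
    inequality gives uniqueness and the convergence of all the other orbits. *)

Section chatterjea.
Context {R : realType} {X : metricType R} {T : X -> X} {k : R}.
Hypotheses (k_ge0 : 0 <= k) (k_lt : 2 * k < 1).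
Hypothesis chatterjea :
  forall x y, mdist (T x) (T y) <= k * (mdist x (T y) + mdist y (T x)).

(** Apply the contraction to [x] and [T x]: one cross term vanishes, the other is split at [T x],
    and the resulting multiple of the left side is absorbed. *)
Lemma chatterjea_defect_decay x :
  mdist (T x) (T (T x)) <= k / (1 - k) * mdist x (T x).
Proof.
have Hc := chatterjea x (T x); rewrite mdistxx addr0 in Hc.
have Ht := ler_wpM2l k_ge0 (metric_triangle x (T x) (T (T x))).
rewrite mulrAC ler_pdivlMr; last by move: k_ge0 k_lt; lra.
by move: Hc Ht; lra.
Qed.

(** Go from [x] to [y] through [T x] and [T y]. The middle leg costs at most [k] times both defects
    plus [2 * k * mdist x y], which moves to the left. *)
Lemma chatterjea_dist_defect x y :
  (1 - 2 * k) * mdist x y <= (1 + k) * (mdist x (T x) + mdist y (T y)).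
Proof.
have Hc := chatterjea x y.
have H1 := metric_triangle x (T x) y.
have H2 := metric_triangle (T x) (T y) y.
rewrite (metric_sym (T y) y) in H2.
have H3 := ler_wpM2l k_ge0 (metric_triangle x y (T y)).
have H4 := ler_wpM2l k_ge0 (metric_triangle y x (T x)).
rewrite (metric_sym y x) in H4.
by move: Hc H1 H2 H3 H4; lra.
Qed.

Lemma chatterjea_fixed_unique x y : T x = x -> T y = y -> x = y.
Proof.
move=> Tx Ty; apply: mdist_positivity; apply/eqP.
rewrite eq_le mdist_ge0 andbT.
have := chatterjea_dist_defect x y; rewrite Tx Ty !mdistxx addr0 mulr0.
by rewrite pmulr_rle0 // subr_gt0.
Qed.

Lemma chatterjea_orbit_defect x n :
  mdist (iter n T x) (iter n.+1 T x) <= (k / (1 - k)) ^+ n * mdist x (T x).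
Proof.
elim: n => [|n IHn]; first by rewrite expr0 mul1r.
apply: (le_trans (chatterjea_defect_decay _)).
rewrite exprS -[leRHS]mulrA ler_wpM2l // divr_ge0 //.
by move: k_ge0 k_lt; lra.
Qed.

Lemma chatterjea_orbit_defect_small x (e : R) : 0 < e ->
  \forall n \near \oo, mdist (iter n T x) (iter n.+1 T x) < e.
Proof.
move=> e0.
have q0 : 0 <= k / (1 - k) by rewrite divr_ge0 //; move: k_ge0 k_lt; lra.
have q1 : `|k / (1 - k)| < 1.
  by rewrite ger0_norm // ltr_pdivrMr; move: k_ge0 k_lt; lra.
have small := cvgr0_norm_lt _ (@cvg_geometric R (mdist x (T x)) _ q1) _ e0.
near=> n; apply: le_lt_trans (chatterjea_orbit_defect x n) _.
rewrite mulrC; apply: le_lt_trans (ler_norm _) _; near: n; exact: small.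
Unshelve. all: by end_near. Qed.

(** Almost fixed points are uniformly close. This serves both the Cauchy property and the
    convergence to a known fixed point. *)
Lemma chatterjea_small_defect_close (e : R) : 0 < e ->
  exists2 r : R, 0 < r & forall x y,
    mdist x (T x) < r -> mdist y (T y) < r -> mdist x y < e.
Proof.
move=> e0; have k2 : 0 < 1 - 2 * k by rewrite subr_gt0.
(* The 4 comes from [1 + k <= 2] times the two defects. *)
exists ((1 - 2 * k) * e / 4) => [|x y xr yr].
  by rewrite divr_gt0 // mulr_gt0.
rewrite -(ltr_pM2l k2); apply: le_lt_trans (chatterjea_dist_defect x y) _.
have : (1 + k) * (mdist x (T x) + mdist y (T y)) <=
       2 * (mdist x (T x) + mdist y (T y)).
  rewrite ler_wpM2r ?addr_ge0 ?mdist_ge0 //; move: k_lt k_ge0; lra.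
by move: xr yr; lra.
Qed.

Lemma chatterjea_orbit_cauchy x : cauchy (iter n T x @[n --> \oo]).
Proof.
apply: cauchy_exP => e e0.
have [r r0 close] := chatterjea_small_defect_close _ e0.
have /filter_ex[N Nr] := chatterjea_orbit_defect_small x _ r0.
(* One orbit point of small defect is the centre of a ball of radius [e] holding a whole tail. *)
exists (iter N T x); near=> n; rewrite ballEmdist /=.
apply: close => //; near: n; exact: chatterjea_orbit_defect_small.
Unshelve. all: by end_near. Qed.

(** The contraction stands in for continuity of [T]: applied to [iter n T x] and [l], it bounds
    [mdist l (T l)] by small terms plus [k * mdist l (T l)], which is absorbed. *)
Lemma chatterjea_orbit_limit_fixed x l :
  iter n T x @[n --> \oo] --> l -> T l = l.
Proof.
move=> xl; apply/esym/mdist_positivity/eqP.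
rewrite eq_le mdist_ge0 andbT; apply/ler_addgt0Pr => e e0; rewrite add0r.
(* With both quantities below [e / 8], the next iterate is within [e / 4] of [l], and the final
   bound is 3 * e / 4 + e / 8 < e. *)
have e8 : 0 < e / 8 by rewrite divr_gt0.
have [n [xn_lt defect_lt]] : exists n, mdist l (iter n T x) < e / 8 /\
    mdist (iter n T x) (iter n.+1 T x) < e / 8.
  apply: (@filter_ex _ \oo); near=> n; split; near: n.
    exact: (metricType_numDomainType.cvgr_dist_lt xl).
  exact: chatterjea_orbit_defect_small.
have H0 := metric_triangle l (iter n T x) (iter n.+1 T x).
have Hc := chatterjea (iter n T x) l; rewrite -iterS in Hc.
have H1 := metric_triangle l (iter n.+1 T x) (T l).
have H2 := ler_wpM2l k_ge0 (metric_triangle (iter n T x) l (T l)).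
rewrite (metric_sym (iter n T x) l) in H2.
(* Replacing [k] by 1/2 makes the remaining estimate linear in the distances, as [lra] requires. *)
have half (u v : X) : k * mdist u v <= mdist u v / 2.
  by rewrite mulrC ler_wpM2l ?mdist_ge0 //; move: k_lt; lra.
move: (half l (T l)) (half l (iter n T x)) (half l (iter n.+1 T x)).
by move: Hc H0 H1 H2 xn_lt defect_lt; lra.
Unshelve. all: by end_near. Qed.

Lemma chatterjea_orbit_cvg_fixed x l :
  T l = l -> iter n T x @[n --> \oo] --> l.
Proof.
move=> Tl; apply/metricType_numDomainType.cvgrPdist_lt => e e0.
have [r r0 close] := chatterjea_small_defect_close _ e0.
near=> n; apply: close; first by rewrite Tl mdistxx.
near: n; exact: chatterjea_orbit_defect_small.
Unshelve. all: by end_near. Qed.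

End chatterjea.

Theorem corollary3p8 (R : realType) (X : perturbedMetricSpace R)
    (hX : pm_complete X)
    (M : R) (hM : 1 <= M)
    (hDM : forall x y : X, pm_D x y <= M * exact_metric x y)
    (T : X -> X) (h : R) (h0 : 0 <= h)
    (hT : forall x y : X, pm_D (T x) (T y) <= h * (pm_D x (T y) + pm_D y (T x)))
    (hMh : 2 * M * h < 1) :
  exists x : X,
    [/\ T x = x,
        forall y : X, T y = y -> y = x
      & forall x0 : X, iter n T x0 @[n --> \oo] --> x].
Proof.
have metric_le_D (x y : X) : mdist x y <= pm_D x y.
  by rewrite mdist_exactE gerBl pm_P_ge0.
have k0 : 0 <= M * h by rewrite mulr_ge0 // (le_trans ler01).
have k1 : 2 * (M * h) < 1 by rewrite mulrA.
have hTd (x y : X) :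
    mdist (T x) (T y) <= M * h * (mdist x (T y) + mdist y (T x)).
  apply: le_trans (metric_le_D _ _) (le_trans (hT x y) _).
  rewrite [M * h]mulrC -[leRHS]mulrA ler_wpM2l // mulrDr.
  exact: lerD (hDM _ _) (hDM _ _).
(* Completeness is applied to the orbit of an arbitrary point [p]. *)
have [p] := pm_nonempty X.
have [x px] := hX _ (chatterjea_orbit_cauchy k0 k1 hTd p).
have Tx := chatterjea_orbit_limit_fixed k0 k1 hTd _ _ px.
exists x; split=> // [y Ty | x0].
  exact: (chatterjea_fixed_unique k0 k1 hTd _ _ Ty Tx).
exact: (chatterjea_orbit_cvg_fixed k0 k1 hTd).
Qed.
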